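(* Let $d\ge 2$, $N\ge 3$ and $m\ge\lceil N/2\rceil$ be integers, and let $\rho$ be a biseparable $N$-qudit state on $\mathbb{C}^d_{A_1}\otimes\cdots\otimes\mathbb{C}^d_{A_N}$ in which the number of systems that can be entangled is limited to $m$, in the following sense: $\rho=\sum_l p_l|\psi_l\rangle\langle\psi_l|$ is a (finite) convex combination of pure states such that for each $l$ there is a partition of $\{A_1,\dots,A_N\}$ into at least two nonempty sets, each of size at most $m$, with respect to which $|\psi_l\rangle$ is a product vector (the partition may depend on $l$). Then $$\min_{1\le i<j\le N}F_{ij}^{(N)}(\rho)\le T_e(d,N,m),\qquad\text{where}\qquad T_e(d,N,m)=1-\frac{2(d-1)\,m(N-m)}{(d+1)N(N-1)}.$$
   Context: An $N$-qudit state is a density operator (positive semidefinite, trace one) on $\mathbb{C}^d_{A_1}\otimes\cdots\otimes\mathbb{C}^d_{A_N}$, each factor being a copy of $\mathbb{C}^d$ with computational basis $\{|0\rangle,\dots,|d-1\rangle\}$. A pure state (unit vector) $|\psi\rangle$ is a product vector with respect to a partition $\{P_1,\dots,P_r\}$ of $\{A_1,\dots,A_N\}$ if $|\psi\rangle=|\psi_{P_1}\rangle\otimes\cdots\otimes|\psi_{P_r}\rangle$ with $|\psi_{P_t}\rangle$ a unit vector of the systems in $P_t$. A state is biseparable if it is a convex combination of projectors onto pure states each of which is a product vector with respect to some partition into two nonempty sets (possibly different for different pure states). Fully entangled fraction: for a two-qudit state $\sigma$ on $\mathbb{C}^d\otimes\mathbb{C}^d$, $f(\sigma)=\max_{|e\rangle}\langle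 e|\sigma|e\rangle$, the maximum being over all maximally entangled unit vectors $|e\rangle=(V\otimes W)\frac{1}{\sqrt d}\sum_{s=0}^{d-1}|s\rangle\otimes|s\rangle$ with $V,W$ unitary $d\times d$ matrices. Controlled teleportation fidelity: fix $i\ne j$, and let $K_{ij}=\{A_1,\dots,A_N\}\setminus\{A_i,A_j\}$. For a tensor product $U=\bigotimes_{A\in K_{ij}}U_A$ of $d\times d$ unitaries and an outcome $J\in\{0,\dots,d-1\}^{N-2}$ (with $|J\rangle$ the corresponding computational basis vector of the systems in $K_{ij}$), let $p_{U,J}=\langle J|U\rho_{K_{ij}}U^\dagger|J\rangle$, where $\rho_{K_{ij}}$ is the reduced state (partial trace) of $\rho$ on $K_{ij}$. When $p_{U,J}>0$, let $\sigma^{U,J}_{A_iA_j}=\frac{1}{p_{U,J}}\,\langle J|U\,\rho\,U^\dagger|J\rangle$, a state on $A_iA_j$ (with $U$ and $\langle J|$ acting on the systems $K_{ij}$ only). Define $$f_{ij}^{(N)}(\rho)=\max_{U}\sum_{J}p_{U,J}\,f\big(\sigma^{U,J}_{A_iA_j}\big),\qquad F_{ij}^{(N)}(\rho)=\frac{d\,f_{ij}^{(N)}(\rho)+1}{d+1},$$ where terms with $p_{U,J}=0$ are taken to be $0$ and the maximum is over all such tensor products $U$. (By the known formula $F=(df+1)/(d+1)$ for the maximal standard teleportation fidelity over a two-qudit state, $F_{ij}^{(N)}$ is the maximal average teleportation fidelity between $A_i$ and $A_j$.) *)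

(* Defs.v *)
From HB Require Import structures.
From mathcomp Require Import all_boot all_order all_algebra.
From mathcomp Require Import complex mxtens.
From mathcomp Require Import classical_sets reals.

Set Implicit Arguments.
Unset Strict Implicit.
Unset Printing Implicit Defensive.

Import Order.TTheory GRing.Theory Num.Theory.
Local Open Scope ring_scope.
Local Open Scope complex_scope.
Local Open Scope sesquilinear_scope.

(* The finType I labels the qudits.  The computational basis of (C^d)^{(x) I} *)
(* is {ffun I -> 'I_d}, and vectors and operators are matrices indexed by the *)
(* enumeration of that basis.                                                 *)
Notation basis d I := {ffun I -> 'I_d}.
Notation ket R d I := 'cV[R[i]]_#|{: basis d I}|.
Notation op R d I := 'M[R[i]]_#|{: basis d I}|.

Notation parties P := {k | k \in P}.

Definition unit_vector (R : realType) (n : nat) (v : 'cV[R[i]]_n) : Prop :=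
  v^t* *m v = 1%:M.

(* The order of R[i] makes 0 <= z imply that z is real, so the second clause  *)
(* entails that A is Hermitian.                                               *)
Definition density (R : realType) (n : nat) (A : 'M[R[i]]_n) : Prop :=
  \tr A = 1 /\ forall v : 'cV[R[i]]_n, 0 <= (v^t* *m A *m v) 0 0.

Section Qudits.
Variables (R : realType) (d : nat).

Definition amp (I : finType) (psi : ket R d I) (x : basis d I) : R[i] :=
  psi (enum_rank x) 0.

Definition entry (I : finType) (A : op R d I) (x y : basis d I) : R[i] :=
  A (enum_rank x) (enum_rank y).

Definition tens_op (I : finType) (U : I -> 'M[R[i]]_d) : op R d I :=
  \matrix_(a, b) \prod_k U k ((enum_val a : basis d I) k) ((enum_val b : basis d I) k).

Section Parties.
Variable N : nat.
Implicit Types (i j k : 'I_N) (P : {set 'I_N}) (rho : op R d 'I_N).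

Definition restrict P (x : basis d 'I_N) : basis d (parties P) :=
  [ffun k => x (val k)].

Definition product_vector (Q : {set {set 'I_N}}) (psi : ket R d 'I_N) : Prop :=
  exists phi : forall P, ket R d (parties P),
    (forall P, P \in Q -> unit_vector (phi P)) /\
    (forall x, amp psi x = \prod_(P in Q) amp (phi P) (restrict P x)).

Definition mixture_of (S : ket R d 'I_N -> Prop) rho : Prop :=
  exists (n : nat) (p : 'I_n -> R) (psi : 'I_n -> ket R d 'I_N),
    [/\ forall l, 0 <= p l,
        \sum_l p l = 1,
        forall l, unit_vector (psi l) /\ S (psi l) &
        rho = \sum_l (p l)%:C *: (psi l *m (psi l)^t*)].

Definition biseparable rho : Prop :=
  mixture_of (fun psi => exists Q : {set {set 'I_N}},
    [/\ finset.partition Q [set: 'I_N], #|Q| = 2%N & product_vector Q psi]) rho.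

Definition entanglement_limited (m : nat) rho : Prop :=
  mixture_of (fun psi => exists Q : {set {set 'I_N}},
    [/\ finset.partition Q [set: 'I_N], (2 <= #|Q|)%N,
        forall P, P \in Q -> (#|P| <= m)%N & product_vector Q psi]) rho.

Definition others i j : {set 'I_N} := ~: [set i; j].

(* The N-qudit basis vector with values a at i, b at j and J elsewhere. *)
Definition glue i j (a b : 'I_d) (J : basis d (parties (others i j))) :
    basis d 'I_N :=
  [ffun k => if insub k is Some k' then J k' else if k == i then a else b].

Definition reduced i j rho : op R d (parties (others i j)) :=
  \matrix_(x, y) \sum_a \sum_b
    entry rho (glue a b (enum_val x)) (glue a b (enum_val y)).

(* U acting on the qudits other than i and j, and the identity on i and j. *)
Definition extend_local i j (U : parties (others i j) -> 'M[R[i]]_d) k :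
    'M[R[i]]_d :=
  if insub k is Some k' then U k' else 1%:M.

(* The partial matrix element <J| rho |J>, as an operator on the factors i    *)
(* and j, in this order.                                                      *)
Definition slice i j rho (J : basis d (parties (others i j))) :
    'M[R[i]]_(d * d) :=
  \matrix_(u, v) entry rho
    (glue (mxtens_unindex u).1 (mxtens_unindex u).2 J)
    (glue (mxtens_unindex v).1 (mxtens_unindex v).2 J).

Definition outcome_prob i j rho (U : parties (others i j) -> 'M[R[i]]_d)
    (J : basis d (parties (others i j))) : R :=
  complex.Re (entry (tens_op U *m reduced i j rho *m (tens_op U)^t*) J J).

Definition post_state i j rho (U : parties (others i j) -> 'M[R[i]]_d)
    (J : basis d (parties (others i j))) : 'M[R[i]]_(d * d) :=
  ((outcome_prob rho U J)^-1)%:C *: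
    slice (tens_op (extend_local U) *m rho *m (tens_op (extend_local U))^t*) J.

End Parties.

Definition phi_plus : 'cV[R[i]]_(d * d) :=
  ((Num.sqrt d%:R)^-1)%:C *:
    \sum_(s < d) (delta_mx s 0 : 'cV[R[i]]_d) *t (delta_mx s 0 : 'cV[R[i]]_d).

Definition max_entangled (e : 'cV[R[i]]_(d * d)) : Prop :=
  exists V W : 'M[R[i]]_d,
    [/\ V \is unitarymx, W \is unitarymx & e = (V *t W) *m phi_plus].

(* The suprema here and in ctrl_fraction are maxima, by compactness of the    *)
(* unitary group.                                                             *)
Definition ent_fraction (sigma : 'M[R[i]]_(d * d)) : R :=
  sup [set x | exists e, max_entangled e /\
                         x = complex.Re ((e^t* *m sigma *m e) 0 0)]%classic.

Definition ctrl_fraction (N : nat) (rho : op R d 'I_N) (i j : 'I_N) : R :=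
  sup [set x | exists U : parties (others i j) -> 'M[R[i]]_d,
        (forall k, U k \is unitarymx) /\
        x = \sum_(J : basis d (parties (others i j)))
              if 0 < outcome_prob rho U J
              then outcome_prob rho U J * ent_fraction (post_state rho U J)
              else 0]%classic.

Definition ctrl_fidelity (N : nat) (rho : op R d 'I_N) (i j : 'I_N) : R :=
  (d%:R * ctrl_fraction rho i j + 1) / (d%:R + 1).

(* The infimum of a finite set, nonempty as soon as N >= 2, i.e. a minimum. *)
Definition min_ctrl_fidelity (N : nat) (rho : op R d 'I_N) : R :=
  inf [set x | exists i j : 'I_N,
                 (i < j)%N /\ x = ctrl_fidelity rho i j]%classic.

End Qudits.

Definition T_e (R : realType) (d N m : nat) : R :=
  1 - 2 * (d%:R - 1) * (m%:R * (N%:R - m%:R))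
      / ((d%:R + 1) * N%:R * (N%:R - 1)).

(* Main.v *)
Require Import Defs.
From mathcomp Require Import all_boot all_order all_algebra complex mxtens reals.
From mathcomp Require Import ring lra zify.

(* If A_i and A_j lie in different blocks of psi_l, then local unitaries and
   a local measurement of the other qudits leave A_i and A_j in a product
   vector, whose overlap with a maximally entangled vector is at most 1/d;
   otherwise the overlap is at most 1.  Hence
     (d + 1) (1 - F_ij) >= (d - 1) \sum_(l | l separates i and j) p_l.
   Averaging over the ordered pairs (i, j), it remains to see that a partition
   into blocks of size at most m, with N <= 2 m, separates at least 2 m (N - m)
   of them. *)

Set Implicit Arguments.
Unset Strict Implicit.
Unset Printing Implicit Defensive.

Section ControlledTeleportation.

Import Order.TTheory GRing.Theory Num.Theory.
Local Open Scope ring_scope.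
Local Open Scope complex_scope.
Local Open Scope sesquilinear_scope.

(** * Squared norms and overlap inequalities *)

Section SquaredNorm.
Variable C : numClosedFieldType.

Definition sqnorm n (v : 'cV[C]_n) : C := \sum_k `|v k 0| ^+ 2.

Lemma sqnormE n (v : 'cV[C]_n) : sqnorm v = (v^t* *m v) 0 0.
Proof. by rewrite mxE; apply: eq_bigr => k _; rewrite !mxE normCK mulrC. Qed.

Lemma sqnorm_unitary n (U : 'M[C]_n) (v : 'cV[C]_n) :
  U \is unitarymx -> sqnorm (U *m v) = sqnorm v.
Proof.
move=> Uu; rewrite !sqnormE trmx_mul map_mxM -mulmxA (mulmxA _ U).
have := Uu; rewrite -trmxC_unitary => /unitarymxP; rewrite trmxCK => ->.
by rewrite mul1mx.
Qed.

(* Lagrange's identity bounds the sum of the moduli of the products. *)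
Lemma cauchy_schwarz (I : finType) (x y : I -> C) :
  `|\sum_i x i * y i| ^+ 2 <= (\sum_i `|x i| ^+ 2) * (\sum_i `|y i| ^+ 2).
Proof.
have le1 : `|\sum_i x i * y i| ^+ 2 <= (\sum_i `|x i| * `|y i|) ^+ 2.
  rewrite lerXn2r ?nnegrE ?sumr_ge0 // => [i _|].
    by rewrite mulr_ge0.
  by apply: le_trans (ler_norm_sum _ _ _) _; under eq_bigr do rewrite normrM.
apply: le_trans le1 _.
set A := \sum_i `|x i| ^+ 2; set B := \sum_i `|y i| ^+ 2; set S := \sum_i _.
have AB : A * B = \sum_i \sum_j `|x i| ^+ 2 * `|y j| ^+ 2 by rewrite big_distrlr.
have BA : A * B = \sum_i \sum_j `|x j| ^+ 2 * `|y i| ^+ 2.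
  by rewrite AB exchange_big.
have SS : S * S = \sum_i \sum_j `|x i| * `|y i| * (`|x j| * `|y j|).
  by rewrite big_distrlr.
have : 0 <= \sum_i \sum_j (`|x i| * `|y j| - `|x j| * `|y i|) ^+ 2.
  apply: sumr_ge0 => i _; apply: sumr_ge0 => j _.
  by rewrite real_exprn_even_ge0 // rpredB // rpredM // normr_real.
have -> : \sum_i \sum_j (`|x i| * `|y j| - `|x j| * `|y i|) ^+ 2 =
    (A * B + A * B) - (S * S + S * S).
  rewrite {1}AB {1}BA SS -!big_split -sumrB; apply: eq_bigr => i _.
  rewrite -!big_split -sumrB; apply: eq_bigr => j _ /=; ring.
by rewrite -!mulr2n subr_ge0 ler_pMn2r.
Qed.

Lemma overlap_le n (e v : 'cV[C]_n) :
  `|(e^t* *m v) 0 0| ^+ 2 <= sqnorm e * sqnorm v.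
Proof.
rewrite mxE; apply: le_trans (cauchy_schwarz _ _) _; rewrite le_eqVlt.
apply/orP; left; apply/eqP; congr (_ * _).
by apply: eq_bigr => k _; rewrite !mxE norm_conjC.
Qed.

(* The vanishing 2 x 2 minors mean that chi has rank at most one. *)
Lemma unitary_rank_one_le n (M : 'M[C]_n) (chi : 'I_n -> 'I_n -> C) :
    M \is unitarymx ->
    (forall a b a' b', chi a b * chi a' b' = chi a b' * chi a' b) ->
  `|\sum_a \sum_b (M a b)^* * chi a b| ^+ 2 <= \sum_a \sum_b `|chi a b| ^+ 2.
Proof.
move=> Mu minor0.
have [/existsP[a0 /existsP[b0 chi0]]|] :=
  boolP [exists a, exists b, chi a b != 0]; last first.
  move=> /existsPn chi0; rewrite big1 ?normr0 ?expr0n /=.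
    by apply: sumr_ge0 => a _; apply: sumr_ge0 => b _; rewrite exprn_ge0.
  move=> a _; rewrite big1 // => b _.
  by have /existsPn/(_ b) := chi0 a; rewrite negbK => /eqP ->; rewrite mulr0.
(* With the nonzero pivot [chi a0 b0], the minors factor [chi] as a column times [beta]; the
   conjugate of [M] then preserves the norm of [beta]. *)
pose beta := \col_b (chi a0 b / chi a0 b0).
have chiE a b : chi a b = chi a b0 * beta b 0.
  by rewrite mxE mulrA -minor0 mulfK.
have -> : \sum_a \sum_b (M a b)^* * chi a b =
          \sum_a chi a b0 * (map_mx Num.conj M *m beta) a 0.
  apply: eq_bigr => a _; rewrite [X in _ * X]mxE mulr_sumr.
  by apply: eq_bigr => b _; rewrite chiE !mxE mulrCA.
apply: le_trans (cauchy_schwarz _ _) _.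
rewrite -/(sqnorm _) sqnorm_unitary ?conjC_unitary // big_distrlr /=.
apply: ler_sum => a _; apply: ler_sum => b _.
by rewrite -exprMn -normrM -chiE.
Qed.

End SquaredNorm.

(** * Ordered pairs separated by a partition *)

Section Counting.
Variables (T : finType) (Q : {set {set T}}).
Hypothesis partQ : partition Q [set: T].

(** A point is separated from the complement of its block. Either all blocks have at most [#|T| - m]
    points, and each point contributes at least [m], or one larger block and its complement already
    supply enough pairs. *)
Lemma separated_pairs_ge m :
    (forall P, P \in Q -> #|P| <= m)%N -> (uphalf #|T| <= m)%N ->
  (2 * (m * (#|T| - m)) <=
   \sum_(i : T) \sum_(j : T) (pblock Q i != pblock Q j))%N.
Proof.
rewrite leq_uphalf_double => le_m hm.
have hT : (2 * (#|T| - m) <= #|T|)%N by lia.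
have /and3P[/eqP covQ tiQ _] := partQ.
have cov i : i \in cover Q by rewrite covQ inE.
have sumE i : (\sum_(j : T) (pblock Q i != pblock Q j) =
               #|T| - #|pblock Q i|)%N.
  rewrite -(cardsC (pblock Q i)) addKn -sum1_card [RHS]big_mkcond /=.
  apply: eq_bigr => j _.
  by rewrite inE -eq_pblock // -?in_setC ?inE //; case: eqP.
under eq_bigr do rewrite sumE.
have blockQ i : pblock Q i \in Q by rewrite pblock_mem.
case: (boolP [forall i, (#|pblock Q i| <= #|T| - m)%N]) => [/forallP small|].
  apply: (@leq_trans (\sum_(i : T) m)%N).
    rewrite sum_nat_const (eq_card (_ : _ =i T)) // mulnCA mulnC leq_mul2r.
    by rewrite hT orbT.
  apply: leq_sum => i _; have := small i.
  (* This rules out [m > #|T|], where the truncated [#|T| - m] is 0. *)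
  have : (0 < #|pblock Q i|)%N.
    by apply/card_gt0P; exists i; rewrite mem_pblock.
  lia.
(* A block P with N - m < #|P| <= m is separated from its complement, which
   counts twice because the pairs are ordered. *)
move=> /forallPn[i0]; set P := pblock Q i0; rewrite -ltnNge => big.
have leP : (#|P| <= m)%N by apply/le_m/blockQ.
rewrite (bigID (mem P)) /= (_ : 2 * _ = m * (#|T| - m) + m * (#|T| - m))%N;
  last by rewrite mul2n addnn.
have leT : (#|P| <= #|T|)%N by apply: max_card.
have hC : (#|P| + #|~: P| = #|T|)%N by rewrite cardsC.
(* For [m <= #|T|] this is [(m - #|P|) * (#|P| - (#|T| - m)) >= 0], by concavity of x(N - x). *)
have conc : (m * (#|T| - m) <= #|P| * #|~: P|)%N by nia.
apply: leq_add; apply: leq_trans conc _.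
  rewrite -sum_nat_const; apply: leq_sum => i iP.
  by rewrite (def_pblock tiQ (blockQ i0)) // -/P -hC addKn.
rewrite mulnC -sum_nat_const [X in (_ <= X)%N](eq_bigl (mem (~: P))); last first.
  by move=> i /=; rewrite !inE.
apply: leq_sum => i; rewrite !inE => iP.
(* A point outside [P] has its block outside [P], so it is separated from all of [P]. *)
have : (pblock Q i \subset ~: P).
  rewrite subsets_disjoint setCK; apply: (trivIsetP tiQ) (blockQ i) (blockQ i0) _.
  by apply: contraNneq iP => blockE; have := cov i; rewrite -mem_pblock blockE.
move=> /subset_leq_card sub.
by rewrite leq_subRL ?max_card // -hC addnC leq_add2l.
Qed.

End Counting.

(** * Overlaps with maximally entangled two-qudit vectors *)

Section Bipartite.
Variables (R : realType) (d : nat).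
Hypothesis d_gt0 : (0 < d)%N.
Local Notation C := R[i].

Lemma sum_mxtens (V : nmodType) m n (F : 'I_(m * n) -> V) :
  \sum_u F u = \sum_a \sum_b F (mxtens_index (a, b)).
Proof.
rewrite pair_bigA (reindex (@mxtens_index m n)) /=.
  by apply: eq_bigr => -[].
by exists (@mxtens_unindex m n) => u _; rewrite (mxtens_indexK, mxtens_unindexK).
Qed.

(** Applying V and W to the two factors of [phi_plus] turns its coefficient matrix, the identity
    over sqrt d, into V W^T over sqrt d. *)
Lemma max_entangled_unitary (e : 'cV[C]_(d * d)) : max_entangled e ->
  exists2 M : 'M[C]_d, M \is unitarymx &
    forall a b, e (mxtens_index (a, b)) 0 = (Num.sqrt d%:R)^-1%:C * M a b.
Proof.
move=> [V [W [Vu Wu ->]]]; exists (V *m W^T).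
  by rewrite mul_unitarymx ?trmx_unitary.
move=> a b; rewrite /phi_plus -scalemxAr mxE; congr (_ * _).
rewrite mulmx_sumr summxE [RHS]mxE; apply: eq_bigr => s _.
(* The column index lives in ['I_(1 * 1)]; writing it as [mxtens_index (0, 0)] lets [tensmxE]
   apply. *)
transitivity (((V *m (delta_mx s 0 : 'cV_d)) *t (W *m (delta_mx s 0 : 'cV_d)))
  (mxtens_index (a, b)) (mxtens_index (0, 0))).
  by rewrite -tensmx_mul; congr (_ _ _); apply: val_inj.
by rewrite tensmxE -!colE !mxE.
Qed.

Lemma sqr_sqrt_dim : `|((Num.sqrt d%:R)^-1)%:C| ^+ 2 = d%:R^-1 :> C.
Proof.
rewrite ger0_norm ?lecR ?invr_ge0 ?sqrtr_ge0 //.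
by rewrite -rmorphXn /= exprVn sqr_sqrtr ?ler0n // fmorphV rmorph_nat.
Qed.

Lemma max_entangled_unit (e : 'cV[C]_(d * d)) : max_entangled e -> sqnorm e = 1.
Proof.
move=> /max_entangled_unitary[M /unitarymxP Mu eE]; rewrite /sqnorm sum_mxtens.
under eq_bigr => a _ do under eq_bigr => b _ do
  rewrite eE normrM exprMn sqr_sqrt_dim.
rewrite (eq_bigr (fun=> d%:R^-1)) => [|a _].
  rewrite sumr_const card_ord -[RHS](@mulVf _ d%:R) ?mulr_natr //.
  by rewrite pnatr_eq0 -lt0n.
rewrite -mulr_sumr -[RHS]mulr1; congr (_ * _).
have := congr1 (fun A : 'M[C]_d => A a a) Mu; rewrite !mxE eqxx mulr1n => <-.
by apply: eq_bigr => b _; rewrite !mxE normCK.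
Qed.

Lemma max_entangled_overlap_le (e chi : 'cV[C]_(d * d)) : max_entangled e ->
  `|(e^t* *m chi) 0 0| ^+ 2 <= sqnorm chi.
Proof.
by move=> /max_entangled_unit e1; have := overlap_le e chi; rewrite e1 mul1r.
Qed.

(** The coefficients of [e] are a unitary matrix over sqrt d: the rank-one bound handles the
    unitary, and squaring the scalar gives 1/d. *)
Lemma max_entangled_product_overlap_le (e chi : 'cV[C]_(d * d)) :
    max_entangled e ->
    (forall a b a' b',
       chi (mxtens_index (a, b)) 0 * chi (mxtens_index (a', b')) 0 =
       chi (mxtens_index (a, b')) 0 * chi (mxtens_index (a', b)) 0) ->
  `|(e^t* *m chi) 0 0| ^+ 2 <= d%:R^-1 * sqnorm chi.
Proof.
move=> /max_entangled_unitary[M Mu eE] minor0.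
have /= := unitary_rank_one_le
  (chi := fun a b => chi (mxtens_index (a, b)) 0) Mu minor0.
rewrite -(ler_pM2l (x := d%:R^-1)) ?invr_gt0 ?ltr0n // => le.
rewrite /sqnorm sum_mxtens; apply: le_trans le.
rewrite -sqr_sqrt_dim -exprMn -normrM mulr_sumr mxE sum_mxtens.
rewrite le_eqVlt; apply/orP; left; apply/eqP; congr (`|_| ^+ 2).
apply: eq_bigr => a _; rewrite mulr_sumr; apply: eq_bigr => b _.
by rewrite !mxE eE rmorphM /= mulrA; congr (_ * _ * _); exact: conjc_real.
Qed.

End Bipartite.

(** * Local operators and products across a cut *)

Section LocalOperations.
Variables (R : realType) (d : nat) (I : finType).
Local Notation C := R[i].
Implicit Types (U : I -> 'M[C]_d) (psi : ket R d I) (x y : basis d I).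

Lemma sum_basis (V : nmodType) (F : 'I_#|{: basis d I}| -> V) :
  \sum_a F a = \sum_(x : basis d I) F (enum_rank x).
Proof. by apply: reindex; apply: onW_bij; apply: enum_rank_bij. Qed.

Lemma sqnorm_amp psi : sqnorm psi = \sum_x `|amp psi x| ^+ 2.
Proof. by rewrite /sqnorm sum_basis. Qed.

Lemma amp_tens_op U psi x :
  amp (tens_op U *m psi) x =
  \sum_(y : basis d I) (\prod_k U k (x k) (y k)) * amp psi y.
Proof.
rewrite /amp mxE sum_basis; apply: eq_bigr => y _.
by rewrite mxE !enum_rankK.
Qed.

(** Inner products of rows factor over the qudits, since a product of sums over ['I_d] is a sum over
    basis vectors. *)
Lemma tens_op_unitary U :
  (forall k, U k \is unitarymx) -> tens_op U \is unitarymx.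
Proof.
move=> Uu; apply/unitarymxP/matrixP => a b; rewrite !mxE.
rewrite -(enum_valK a) -(enum_valK b).
move: (enum_val a) (enum_val b) => x y; rewrite sum_basis.
have -> : (enum_rank x == enum_rank y)%:R =
    \prod_k ((x k == y k)%:R : C).
  rewrite (inj_eq enum_rank_inj); case: eqP => [->|neq_xy].
    by rewrite big1 // => k _; rewrite eqxx.
  have /existsP[k neq_k] : [exists k, x k != y k].
    apply: contra_notT neq_xy => /existsPn eq_xy; apply/ffunP => k.
    by have := eq_xy k; rewrite negbK => /eqP.
  by rewrite (bigD1 k) //= (negPf neq_k) mul0r.
under [RHS]eq_bigr => k _.
  have := congr1 (fun A : 'M[C]_d => A (x k) (y k)) (unitarymxP (Uu k)).
  rewrite [in RHS]mxE => <-; rewrite mxE; over.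
rewrite bigA_distr_bigA; apply: eq_bigr => z _; rewrite !mxE !enum_rankK.
rewrite rmorph_prod -big_split; apply: eq_bigr => k _.
by rewrite !mxE.
Qed.

Definition splice (P : {set I}) x y : basis d I :=
  [ffun k => if k \in P then x k else y k].

(* Division-free form of: psi is a product across the cut between P and its
   complement. *)
Definition splits (P : {set I}) psi : Prop :=
  forall x y, amp psi x * amp psi y =
              amp psi (splice P x y) * amp psi (splice P y x).

Lemma splits_tens_op P U psi : splits P psi -> splits P (tens_op U *m psi).
Proof.
move=> split_psi x x'; rewrite !amp_tens_op !big_distrlr !pair_bigA /=.
(* Expand both sides over pairs of basis vectors and exchange the
   coordinates outside P within each pair. *)
pose h (p : basis d I * basis d I) := (splice P p.1 p.2, splice P p.2 p.1).
have hK : involutive h.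
  move=> [y y']; rewrite /h /=; congr (_, _); apply/ffunP => k;
  by rewrite !ffunE /=; case: ifP => ->.
rewrite [RHS](reindex_inj (inv_inj hK)); apply: eq_bigr => -[y y'] _ /=.
rewrite mulrACA split_psi [RHS]mulrACA; congr (_ * _); rewrite -!big_split.
by apply: eq_bigr => k _ /=; rewrite !ffunE; case: ifP => // _; rewrite mulrC.
Qed.

End LocalOperations.

(** * Measuring all qudits but two *)

Section Parties.
Variables (R : realType) (d N : nat).
Local Notation C := R[i].
Implicit Types (psi : ket R d 'I_N) (i j : 'I_N).

(** Splicing along [P] leaves the two values of the factor of [P] in place and swaps those of every
    other factor. *)
Lemma product_vector_splits (Q : {set {set 'I_N}}) (P : {set 'I_N}) psi :
  partition Q [set: 'I_N] -> P \in Q -> product_vector Q psi -> splits P psi.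
Proof.
move=> /and3P[_ /trivIsetP tiQ _] PQ [phi [_ psiE]] x y.
have restrictP z z' : Defs.restrict P (splice P z z') = Defs.restrict P z.
  by apply/ffunP => -[k kP]; rewrite !ffunE /= kP.
have restrictN P' z z' : P' \in Q -> P' != P ->
    Defs.restrict P' (splice P z z') = Defs.restrict P' z'.
  move=> P'Q neqP; apply/ffunP => -[k kP']; rewrite !ffunE /=.
  by rewrite (disjointFr (tiQ _ _ P'Q PQ neqP) kP').
rewrite !psiE -!big_split; apply: eq_bigr => P' P'Q.
have [->|neqP] := eqVneq P' P; first by rewrite !restrictP.
by rewrite !restrictN //= mulrC.
Qed.

Section Pair.
Variables i j : 'I_N.
Hypothesis neq_ij : i != j.
Local Notation rest := (basis d (parties (others i j))).

Lemma glue_fst (a b : 'I_d) (J : rest) : glue a b J i = a.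
Proof. by rewrite ffunE insubN ?eqxx // !inE eqxx. Qed.

Lemma glue_snd (a b : 'I_d) (J : rest) : glue a b J j = b.
Proof.
by rewrite ffunE insubN ?inE ?eqxx ?orbT // eq_sym (negPf neq_ij).
Qed.

Lemma restrict_glue (a b : 'I_d) (J : rest) :
  Defs.restrict (others i j) (glue a b J) = J.
Proof. by apply/ffunP => k; rewrite !ffunE valK. Qed.

Lemma glue_restrict (x : basis d 'I_N) :
  glue (x i) (x j) (Defs.restrict (others i j) x) = x.
Proof.
apply/ffunP => k; rewrite ffunE.
case: insubP => [u _ <-|]; first by rewrite ffunE.
by rewrite !inE negbK => /orP[] /eqP ->; rewrite ?eqxx // eq_sym (negPf neq_ij).
Qed.

Lemma splice_glue (P : {set 'I_N}) (a b a' b' : 'I_d) (J : rest) :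
  i \in P -> j \notin P -> splice P (glue a b J) (glue a' b' J) = glue a b' J.
Proof.
move=> iP jP; apply/ffunP => k; rewrite !ffunE; case: insubP => [u _ _|].
  by case: ifP.
rewrite !inE negbK => /orP[] /eqP ->; first by rewrite iP eqxx.
by rewrite (negPf jP) eq_sym (negPf neq_ij).
Qed.

(** The unnormalized vector left on the factors i and j by outcome [J]; the vector counterpart of
    [slice]. *)
Definition project (J : rest) psi : 'cV[C]_(d * d) :=
  \col_u amp psi (glue (mxtens_unindex u).1 (mxtens_unindex u).2 J).

Lemma sum_sqnorm_project psi : \sum_J sqnorm (project J psi) = sqnorm psi.
Proof.
rewrite sqnorm_amp /sqnorm pair_bigA /=.
pose h (x : basis d 'I_N) :=
  (Defs.restrict (others i j) x, mxtens_index (x i, x j)).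
rewrite (reindex h) /=.
  by apply: eq_bigr => x _; rewrite mxE mxtens_indexK glue_restrict.
apply: onW_bij; exists
  (fun p => glue (mxtens_unindex p.2).1 (mxtens_unindex p.2).2 p.1) => [x|[J u]].
  by rewrite [(h x).2]/= mxtens_indexK glue_restrict.
rewrite /h restrict_glue glue_fst glue_snd -[in RHS](mxtens_unindexK u).
by case: (mxtens_unindex u).
Qed.

(** As both basis vectors share [J], splicing along [P] exchanges only their values at j. *)
Lemma project_minor (P : {set 'I_N}) psi (J : rest) (a b a' b' : 'I_d) :
    splits P psi -> i \in P -> j \notin P ->
  project J psi (mxtens_index (a, b)) 0 *
    project J psi (mxtens_index (a', b')) 0 =
  project J psi (mxtens_index (a, b')) 0 *
    project J psi (mxtens_index (a', b)) 0.
Proof.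
by move=> split_psi iP jP; rewrite !mxE !mxtens_indexK /= split_psi !splice_glue.
Qed.

(** Conjugation by [T] and slicing at [J] keep each term of rank one, so its quadratic form at [e]
    is a squared overlap. *)
Lemma overlap_mixture n (p : 'I_n -> R) (psi : 'I_n -> ket R d 'I_N)
    (T : op R d 'I_N) (e : 'cV[C]_(d * d)) (J : rest) :
  let rho := \sum_l (p l)%:C *: (psi l *m (psi l)^t*) in
  (e^t* *m slice (T *m rho *m T^t*) J *m e) 0 0 =
  \sum_l (p l)%:C * `|(e^t* *m project J (T *m psi l)) 0 0| ^+ 2.
Proof.
move=> rho.
have -> : slice (T *m rho *m T^t*) J =
    \sum_l (p l)%:C *:
      (project J (T *m psi l) *m (project J (T *m psi l))^t*).
  rewrite /rho mulmx_sumr mulmx_suml; apply/matrixP => u v.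
  rewrite mxE /entry !summxE; apply: eq_bigr => l _.
  have -> : T *m ((p l)%:C *: (psi l *m (psi l)^t*)) *m T^t* =
      (p l)%:C *: ((T *m psi l) *m (T *m psi l)^t*).
    by rewrite trmx_mul map_mxM -scalemxAr -scalemxAl !mulmxA.
  move: (T *m psi l) => phi.
  by rewrite [LHS]mxE [RHS]mxE ![(_ *m _) _ _]mxE !big_ord1 !mxE.
rewrite mulmx_sumr mulmx_suml summxE; apply: eq_bigr => l _.
rewrite -scalemxAr -scalemxAl mxE; congr (_ * _).
rewrite mulmxA -(mulmxA _ _ e) [LHS]mxE big_ord1 normCK; congr (_ * _).
by rewrite -[e in LHS]trmxCK -map_mxM -trmx_mul !mxE.
Qed.

(** The weight [w l], later 1/d or 1, bounds overlaps uniformly in [U], [e] and [J], so the bound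
    passes through both suprema. *)
Lemma ctrl_fraction_le n (p w : 'I_n -> R) (psi : 'I_n -> ket R d 'I_N) :
    (forall l, 0 <= p l) -> (forall l, unit_vector (psi l)) ->
    (forall l, 0 <= w l) ->
    (forall l U e (J : rest), max_entangled e ->
      `|(e^t* *m project J (tens_op U *m psi l)) 0 0| ^+ 2 <=
        (w l)%:C * sqnorm (project J (tens_op U *m psi l))) ->
  ctrl_fraction (\sum_l (p l)%:C *: (psi l *m (psi l)^t*)) i j <=
  \sum_l p l * w l.
Proof.
move=> p_ge0 psi_unit w_ge0 ov_le; set rho := \sum_l _ *: _.
apply: ge_sup.
  (* [ge_sup] requires a nonempty set; identity matrices provide an element. *)
  eexists; exists (fun=> 1%:M); split; last reflexivity.
  by move=> k; apply/unitarymxP; rewrite trmx1 map_mx1 mulmx1.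
move=> _ [U [Uu ->]]; set T := tens_op (extend_local U).
(* p_J cancels against the normalization of the post-measurement state, so
   only the squared norms c l J, which sum to 1 over J, are left. *)
have Tu : T \is unitarymx.
  apply: tens_op_unitary => k; rewrite /extend_local; case: insubP => // _.
  by apply/unitarymxP; rewrite trmx1 map_mx1 mulmx1.
pose c l J := sqnorm (project J (T *m psi l)).
have c_ge0 l J : 0 <= c l J by apply: sumr_ge0 => u _; rewrite exprn_ge0.
have sum_c l : \sum_J complex.Re (c l J) = 1.
  rewrite -(raddf_sum (@complex.Re R : Rcomplex R -> R)) sum_sqnorm_project.
  by rewrite sqnorm_unitary // sqnormE psi_unit mxE eqxx.
have -> : \sum_l p l * w l = \sum_J \sum_l p l * w l * complex.Re (c l J).
  rewrite exchange_big /=; apply: eq_bigr => l _.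
  by rewrite -mulr_sumr sum_c mulr1.
have Re_c_ge0 l J : 0 <= complex.Re (c l J).
  by have := c_ge0 l J; rewrite lecE => /andP[].
have cE l J : c l J = (complex.Re (c l J))%:C by rewrite RRe_real ?ger0_real.
apply: ler_sum => J _; case: ifP => [p_gt0|_]; last first.
  by apply: sumr_ge0 => l _; rewrite !mulr_ge0.
rewrite mulrC -ler_pdivlMr //; apply: ge_sup.
  eexists; exists ((1%:M *t 1%:M) *m phi_plus R d); split; last reflexivity.
  exists 1%:M, 1%:M.
  by split=> //; apply/unitarymxP; rewrite trmx1 map_mx1 mulmx1.
move=> _ [e [e_max ->]]; rewrite /post_state -scalemxAr -scalemxAl mxE.
rewrite -/T overlap_mixture mulrC ler_pdivlMr //.
set s := \sum_l _.
have : s <= (\sum_l p l * w l * complex.Re (c l J))%:C.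
  rewrite rmorph_sum; apply: ler_sum => l _; rewrite !rmorphM /= -cE -mulrA.
  by rewrite ler_wpM2l ?lecR // ov_le.
rewrite lecE => /andP[_]; rewrite /=.
suff -> : complex.Re (s * (outcome_prob rho U J)^-1%:C) =
  complex.Re s / outcome_prob rho U J by rewrite divfK // gt_eqF.
by case: s => a b /=; rewrite mulr0 subr0.
Qed.

End Pair.
End Parties.

(** * Averaging over pairs of qudits *)

Section Average.
Variables (R : realType) (d N m n : nat).
Variables (p : 'I_n -> R) (psi : 'I_n -> ket R d 'I_N).
Variable Q : 'I_n -> {set {set 'I_N}}.
Hypotheses (d_gt0 : (0 < d)%N) (p_ge0 : forall l, 0 <= p l).
Hypothesis sum_p : \sum_l p l = 1.
Hypothesis psi_unit : forall l, unit_vector (psi l).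
Hypothesis partQ : forall l, partition (Q l) [set: 'I_N].
Hypothesis psi_product : forall l, product_vector (Q l) (psi l).

Let rho := \sum_l (p l)%:C *: (psi l *m (psi l)^t*).
Let separated l i j := pblock (Q l) i != pblock (Q l) j.

(** Let s be the total weight of the components separating i and j. Weights 1/d and 1 give d f <= d
    - (d - 1) s, while (d + 1)(1 - F) = d - d f. *)
Lemma ctrl_fidelity_le i j : i != j ->
  (d%:R - 1) * (\sum_l p l * (separated l i j)%:R) <=
  (d%:R + 1) * (1 - ctrl_fidelity rho i j).
Proof.
move=> neq_ij.
pose w l : R := if separated l i j then d%:R^-1 else 1.
have d_gt0R : 0 < d%:R :> R by rewrite ltr0n.
have frac_le : ctrl_fraction rho i j <= \sum_l p l * w l.
  apply: ctrl_fraction_le => // [l|l U e J e_max].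
    by rewrite /w; case: ifP; rewrite // invr_ge0 ler0n.
  rewrite /w; case: ifP => [sep|_]; last first.
    by rewrite mul1r max_entangled_overlap_le.
  rewrite fmorphV rmorph_nat; apply: max_entangled_product_overlap_le => //.
  move=> a b a' b'; have /and3P[/eqP covQ tiQ _] := partQ l.
  have cov k : k \in cover (Q l) by rewrite covQ inE.
  apply: (@project_minor _ _ _ _ _ neq_ij (pblock (Q l) i)).
  - apply: splits_tens_op; apply: product_vector_splits (psi_product l) => //.
    exact: pblock_mem.
  - by rewrite mem_pblock.
  - by rewrite -eq_pblock.
have wE : d%:R * (\sum_l p l * w l) =
    d%:R - (d%:R - 1) * (\sum_l p l * (separated l i j)%:R).
  have -> : d%:R - (d%:R - 1) * (\sum_l p l * (separated l i j)%:R) =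
      d%:R * (\sum_l p l) - (d%:R - 1) * (\sum_l p l * (separated l i j)%:R).
    by rewrite sum_p mulr1.
  rewrite !mulr_sumr -sumrB; apply: eq_bigr => l _.
  rewrite /w; case: (separated l i j) => /=; last by rewrite !mulr0 subr0 mulr1.
  by rewrite mulrCA mulfV ?gt_eqF //; ring.
have := ler_wpM2l (ltW d_gt0R) frac_le; rewrite wE.
rewrite /ctrl_fidelity mulrBr mulr1 [_ * (_ / _)]mulrC.
by rewrite divfK ?gt_eqF ?addr_gt0 //; lra.
Qed.

(** Separation is symmetric in i and j, so the bound extends from i < j to all ordered pairs of
    distinct qudits. *)
Lemma min_ctrl_fidelity_le i j : i != j ->
  (d%:R - 1) * (\sum_l p l * (separated l i j)%:R) <=
  (d%:R + 1) * (1 - min_ctrl_fidelity rho).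
Proof.
have lb : classical_sets.has_lbound
    (fun x => exists i j : 'I_N, (i < j)%N /\ x = ctrl_fidelity rho i j).
  (* Minus the sum of all moduli is below each fidelity; [ge_inf] needs such a lower bound. *)
  exists (- \sum_i \sum_j `|ctrl_fidelity rho i j|) => _ [k [l [_ ->]]].
  rewrite lerNl (bigD1 k) //= (bigD1 l) //= -addrA.
  apply: le_trans (ler_norm _) _; rewrite normrN lerDl addr_ge0 ?sumr_ge0 //.
  by move=> k' _; apply: sumr_ge0.
have lt_case (k k' : 'I_N) : (k < k')%N ->
    (d%:R - 1) * (\sum_l p l * (separated l k k')%:R) <=
    (d%:R + 1) * (1 - min_ctrl_fidelity rho).
  move=> lt_kk'; apply: le_trans (ctrl_fidelity_le _) _.
    by rewrite neq_ltn lt_kk'.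
  rewrite ler_pM2l ?addr_gt0 ?ltr0n // lerD2l lerN2.
  by apply: ge_inf => //; exists k, k'.
rewrite neq_ltn => /orP[|lt_ji]; first exact: lt_case.
under eq_bigr do rewrite /separated eq_sym.
exact: lt_case.
Qed.

Lemma min_ctrl_fidelity_le_T_e :
    (2 <= N)%N -> (uphalf N <= m)%N ->
    (forall l P, P \in Q l -> (#|P| <= m)%N) ->
  min_ctrl_fidelity rho <= T_e R d N m.
Proof.
move=> N_ge2 hm le_m; set f := min_ctrl_fidelity rho.
have d1_ge0 : 0 <= d%:R - 1 :> R by rewrite subr_ge0 ler1n.
have N_gt0 : 0 < N%:R :> R by rewrite ltr0n ltnW.
have N1_gt0 : 0 < N%:R - 1 :> R by rewrite subr_gt0 ltr1n.
(* [S] is the mean number of separated ordered pairs; counting bounds it below, the fidelities bound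
   it above. *)
pose S : R := \sum_l p l * \sum_i \sum_j (separated l i j)%:R.
have S_ge : 2 * (m%:R * (N%:R - m%:R)) <= S.
  have -> : 2 * (m%:R * (N%:R - m%:R)) =
      \sum_l p l * (2 * (m%:R * (N%:R - m%:R))) by rewrite -mulr_suml sum_p mul1r.
  apply: ler_sum => l _; rewrite ler_wpM2l //.
  have := separated_pairs_ge (partQ l) (le_m l); rewrite card_ord => /(_ hm).
  rewrite -(ler_nat R) natr_sum => le.
  rewrite (eq_bigr _ (fun i _ => esym (natr_sum _ _ _ _))).
  (* For [m > N] the real difference is negative while the natural one is 0, hence an inequality
     here. *)
  apply: le_trans le; rewrite !natrM ler_pM2l // ler_wpM2l //.
  by rewrite lerBlDr -natrD ler_nat; lia.
have S_le : (d%:R - 1) * S <= N%:R * (N%:R - 1) * ((d%:R + 1) * (1 - f)).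
  (* The diagonal contributes 0, which leaves N(N - 1) ordered pairs. *)
  have -> : (d%:R - 1) * S = \sum_(i < N) \sum_(j < N | j != i)
      (d%:R - 1) * (\sum_l p l * (separated l i j)%:R).
    rewrite /S mulr_sumr; under eq_bigr do rewrite mulr_sumr mulr_sumr.
    rewrite exchange_big; apply: eq_bigr => i _ /=.
    under eq_bigr do rewrite mulr_sumr mulr_sumr.
    rewrite exchange_big (bigD1 i) //= big1 ?add0r => [|l _].
      by apply: eq_bigr => j _; rewrite mulr_sumr.
    by rewrite /separated eqxx !mulr0.
  have -> : N%:R * (N%:R - 1) * ((d%:R + 1) * (1 - f)) =
      \sum_(i < N) \sum_(j < N | j != i) (d%:R + 1) * (1 - f).
    under eq_bigr => i _.
      rewrite sumr_const (_ : #|_| = N.-1); last first.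
        by have := cardC1 i; rewrite card_ord.
      over.
    rewrite sumr_const card_ord -!mulrnA -[RHS]mulr_natl natrM.
    rewrite -subn1 natrB ?(leq_trans _ N_ge2) //.
    by rewrite [_ * N%:R]mulrC.
  apply: ler_sum => i _; apply: ler_sum => j neq_ji.
  by apply: min_ctrl_fidelity_le; rewrite eq_sym.
have d_gt0R : 0 < d%:R + 1 :> R by rewrite addr_gt0 ?ltr0n.
rewrite /T_e lerBrDl -lerBrDr ler_pdivrMr -?mulrA ?mulr_gt0 //.
have := ler_wpM2l d1_ge0 S_ge; move: S_le; lra.
Qed.

End Average.

End ControlledTeleportation.

Theorem corollary3 (R : realType) (d N m : nat) (rho : op R d 'I_N)
  (hd : (2 <= d)%N) (hN : (3 <= N)%N) (hm : (uphalf N <= m)%N)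
  (rho_state : density rho) (rho_bisep : biseparable rho)
  (rho_limited : entanglement_limited m rho) :
  (min_ctrl_fidelity rho <= T_e R d N m)%R.
Proof.
have [n [p [psi [p_ge0 sum_p psiP ->]]]] := rho_limited.
have [Q QP] := fin_all_exists (fun l => proj2 (psiP l)).
apply: (@min_ctrl_fidelity_le_T_e _ _ _ _ _ _ _ Q) => //.
- exact: ltnW.
- by move=> l; have [] := psiP l.
- by move=> l; have [] := QP l.
- by move=> l; have [] := QP l.
- exact: ltnW.
- by move=> l P; have [_ _ + _] := QP l; apply.
Qed.
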